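(* The reflection $H\vdash I:2Cat\rightarrow 2Preord$ has stable units.
   Context: $2Cat$ is the category of all (small, strict) 2-categories and 2-functors. $2Preord$ is its full subcategory of 2-preorders, i.e. those 2-categories in which any two 2-cells with the same vertical domain (a 1-cell $f$) and the same vertical codomain (a 1-cell $g$) are equal. $H:2Preord\to 2Cat$ is the full inclusion; its left adjoint $I$ keeps objects and 1-cells of a 2-category and identifies all 2-cells having the same vertical domain and the same vertical codomain. The unit is $\eta:1_{2Cat}\to HI$. The reflection has stable units if, for every 2-category $C$ and every 2-functor $g:D\to HI(C)$ from any 2-category $D$, $I$ sends the projection $C\times_{HI(C)}D\to D$ (the pullback of $\eta_C$ along $g$, in $2Cat$) to an isomorphism. *)

(* Defs.v *)
From Stdlib Require Import FunctionalExtensionality ProofIrrelevance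
  ClassicalEpsilon.

Set Implicit Arguments.
Unset Strict Implicit.
Unset Printing Implicit Defensive.

Record category := Category {
  obj :> Type;
  hom : obj -> obj -> Type;
  idm : forall X, hom X X;
  cmp : forall X Y Z, hom Y Z -> hom X Y -> hom X Z;
  cmp_idr : forall X Y (f : hom X Y), cmp f (idm X) = f;
  cmp_idl : forall X Y (f : hom X Y), cmp (idm Y) f = f;
  cmp_assoc : forall W X Y Z (h : hom Y Z) (g : hom X Y) (f : hom W X),
    cmp h (cmp g f) = cmp (cmp h g) f
}.
Arguments hom {c} X Y.
Arguments idm {c} X.
Arguments cmp {c X Y Z} g f.

Declare Scope cat_scope.
Local Open Scope cat_scope.
Notation "g \o f" := (cmp g f) (at level 50, left associativity) : cat_scope.

Record functor (A B : category) := Functor {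
  fobj :> A -> B;
  fmap : forall X Y, hom X Y -> hom (fobj X) (fobj Y);
  fmap_id : forall X, fmap (idm X) = idm (fobj X);
  fmap_cmp : forall X Y Z (g : hom Y Z) (f : hom X Y),
    fmap (g \o f) = fmap g \o fmap f
}.
Arguments fmap {A B} f {X Y} _ : rename.

Definition full_subcategory (A : category) (P : A -> Prop) : category :=
  {| obj := {X : A | P X};
     hom X Y := hom (proj1_sig X) (proj1_sig Y);
     idm X := idm (proj1_sig X);
     cmp X Y Z g f := g \o f;
     cmp_idr X Y f := cmp_idr f;
     cmp_idl X Y f := cmp_idl f;
     cmp_assoc W X Y Z h g f := cmp_assoc h g f |}.

Definition full_inclusion (A : category) (P : A -> Prop) :
    functor (full_subcategory P) A :=
  {| fobj (X : full_subcategory P) := proj1_sig X;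
     fmap X Y f := f;
     fmap_id X := eq_refl;
     fmap_cmp X Y Z g f := eq_refl |}.

(** [adjunction L R]: [L] is left adjoint to [R], presented by its unit, a
    natural transformation all of whose components are universal arrows. *)
Record adjunction (A B : category) (L : functor A B) (R : functor B A) :=
  Adjunction {
    adj_unit : forall X : A, hom X (R (L X));
    adj_unit_natural : forall (X Y : A) (f : hom X Y),
      adj_unit Y \o f = fmap R (fmap L f) \o adj_unit X;
    adj_unit_universal : forall (X : A) (Y : B) (f : hom X (R Y)),
      exists! h : hom (L X) Y, fmap R h \o adj_unit X = f
  }.
Arguments adj_unit {A B L R} a X.

Definition is_iso (A : category) (X Y : A) (f : hom X Y) : Prop :=
  exists g : hom Y X, g \o f = idm X /\ f \o g = idm Y.

Definition is_pullback (A : category) (X Y Z P : A)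
    (f : hom X Z) (g : hom Y Z) (p1 : hom P X) (p2 : hom P Y) : Prop :=
  f \o p1 = g \o p2 /\
  forall (Q : A) (q1 : hom Q X) (q2 : hom Q Y), f \o q1 = g \o q2 ->
    exists! u : hom Q P, p1 \o u = q1 /\ p2 \o u = q2.

Definition has_stable_units (A B : category) (L : functor A B)
    (R : functor B A) (adj : adjunction L R) : Prop :=
  forall (C D : A) (g : hom D (R (L C)))
    (P : A) (p1 : hom P C) (p2 : hom P D),
    is_pullback (adj_unit adj C) g p1 p2 -> is_iso (fmap L p2).

(** A category structure with set of objects [O] and set of arrows [A]; the
    composite [comp g f] ("[g] after [f]") is defined only on composable pairs.
    Keeping all arrows in one type, instead of a family of hom-types, makes the
    strict laws of a 2-category plain equations, without transport. *)
Record cat_on (O A : Type) := CatOn {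
  dom : A -> O;
  cod : A -> O;
  idn : O -> A;
  comp : forall g f : A, dom g = cod f -> A;
  dom_idn : forall x, dom (idn x) = x;
  cod_idn : forall x, cod (idn x) = x;
  dom_comp : forall g f p, dom (@comp g f p) = dom f;
  cod_comp : forall g f p, cod (@comp g f p) = cod g;
  comp_idr : forall f p, @comp f (idn (dom f)) p = f;
  comp_idl : forall f p, @comp (idn (cod f)) f p = f;
  comp_assoc : forall h g f p q p' q',
    @comp h (@comp g f q) p' = @comp (@comp h g p) f q'
}.
Arguments comp {O A} c g f _.

Record preserves_cat (O A O' A' : Type) (S : cat_on O A) (S' : cat_on O' A')
    (F0 : O -> O') (F1 : A -> A') : Prop := PreservesCat {
  pres_dom : forall f, dom S' (F1 f) = F0 (dom S f);
  pres_cod : forall f, cod S' (F1 f) = F0 (cod S f);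
  pres_idn : forall x, F1 (idn S x) = idn S' (F0 x);
  pres_comp : forall g f p q, F1 (comp S g f p) = comp S' (F1 g) (F1 f) q
}.

(** A 2-category consists of 0-, 1- and 2-cells with three category structures:
    1-cells over 0-cells ([base]), 2-cells over 1-cells (vertical composition)
    and 2-cells over 0-cells (horizontal composition). *)
Record two_cat := TwoCat {
  cell0 : Type;
  cell1 : Type;
  cell2 : Type;
  base : cat_on cell0 cell1;
  vert : cat_on cell1 cell2;
  horiz : cat_on cell0 cell2;
  hdom_vdom : forall a, dom base (dom vert a) = dom horiz a;
  hdom_vcod : forall a, dom base (cod vert a) = dom horiz a;
  hcod_vdom : forall a, cod base (dom vert a) = cod horiz a;
  hcod_vcod : forall a, cod base (cod vert a) = cod horiz a;
  vdom_hcomp : forall b a p q,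
    dom vert (comp horiz b a p) = comp base (dom vert b) (dom vert a) q;
  vcod_hcomp : forall b a p q,
    cod vert (comp horiz b a p) = comp base (cod vert b) (cod vert a) q;
  vidn_idn : forall x, idn vert (idn base x) = idn horiz x;
  vidn_comp : forall g f p q,
    idn vert (comp base g f p) = comp horiz (idn vert g) (idn vert f) q;
  interchange : forall b' b a' a p q r s u v,
    comp horiz (comp vert b' b p) (comp vert a' a q) u
    = comp vert (comp horiz b' a' r) (comp horiz b a s) v
}.
Arguments base : clear implicits.
Arguments vert : clear implicits.
Arguments horiz : clear implicits.

Record two_functor (C D : two_cat) := TwoFunctor {
  map0 : cell0 C -> cell0 D;
  map1 : cell1 C -> cell1 D;
  map2 : cell2 C -> cell2 D;
  pres_base : preserves_cat (base C) (base D) map0 map1;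
  pres_vert : preserves_cat (vert C) (vert D) map1 map2;
  pres_horiz : preserves_cat (horiz C) (horiz D) map0 map2
}.

Lemma two_functor_eq (C D : two_cat) (F G : two_functor C D) :
  (forall x, map0 F x = map0 G x) -> (forall f, map1 F f = map1 G f) ->
  (forall a, map2 F a = map2 G a) -> F = G.
Proof.
destruct F as [F0 F1 F2 Fb Fv Fh], G as [G0 G1 G2 Gb Gv Gh]; simpl.
intros E0 E1 E2.
apply functional_extensionality in E0, E1, E2; subst.
f_equal; apply proof_irrelevance.
Qed.

Lemma comp_congr (O A : Type) (S : cat_on O A) (g g' f f' : A) p p' :
  g = g' -> f = f' -> comp S g f p = comp S g' f' p'.
Proof. intros; subst; f_equal; apply proof_irrelevance. Qed.

Lemma comp_idr' (O A : Type) (S : cat_on O A) (f e : A) p :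
  e = idn S (dom S f) -> comp S f e p = f.
Proof. intros; subst; apply comp_idr. Qed.

Lemma comp_idl' (O A : Type) (S : cat_on O A) (f e : A) p :
  e = idn S (cod S f) -> comp S e f p = f.
Proof. intros; subst; apply comp_idl. Qed.

Lemma preserves_cat_id (O A : Type) (S : cat_on O A) :
  preserves_cat S S (fun x => x) (fun f => f).
Proof. split; auto; intros; now apply comp_congr. Qed.

Lemma preserves_cat_cmp (O A O' A' O'' A'' : Type)
    (S : cat_on O A) (S' : cat_on O' A') (S'' : cat_on O'' A'')
    (F0 : O -> O') (F1 : A -> A') (G0 : O' -> O'') (G1 : A' -> A'') :
  preserves_cat S' S'' G0 G1 -> preserves_cat S S' F0 F1 ->
  preserves_cat S S'' (fun x => G0 (F0 x)) (fun f => G1 (F1 f)).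
Proof.
intros HG HF; split; intros.
- now rewrite (pres_dom HG), (pres_dom HF).
- now rewrite (pres_cod HG), (pres_cod HF).
- now rewrite (pres_idn HF), (pres_idn HG).
- assert (r : dom S' (F1 g) = cod S' (F1 f))
    by now rewrite (pres_dom HF), (pres_cod HF), p.
  now rewrite (pres_comp HF p r), (pres_comp HG r q).
Qed.

Definition two_functor_id (C : two_cat) : two_functor C C :=
  TwoFunctor (preserves_cat_id (base C)) (preserves_cat_id (vert C))
    (preserves_cat_id (horiz C)).

Definition two_functor_cmp (C D E : two_cat)
    (G : two_functor D E) (F : two_functor C D) : two_functor C E :=
  TwoFunctor (preserves_cat_cmp (pres_base G) (pres_base F))
    (preserves_cat_cmp (pres_vert G) (pres_vert F))
    (preserves_cat_cmp (pres_horiz G) (pres_horiz F)).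

Definition Cat2 : category.
Proof.
refine {| obj := two_cat; hom := two_functor;
          idm := two_functor_id; cmp := two_functor_cmp |};
  intros; now apply two_functor_eq.
Defined.

Definition is_two_preorder (C : two_cat) : Prop :=
  forall a b : cell2 C,
    dom (vert C) a = dom (vert C) b -> cod (vert C) a = cod (vert C) b -> a = b.

Definition Preord2 : category := @full_subcategory Cat2 is_two_preorder.

Definition incl_preord : functor Preord2 Cat2 := @full_inclusion Cat2 is_two_preorder.

(** The quotient of the 2-cells of [C] identifying those with the same vertical
    domain and codomain: the class of [a] is represented by its boundary, so
    the quotient is the set of those pairs of 1-cells that bound a 2-cell. *)
Definition icell2 (C : two_cat) : Type :=
  {p : cell1 C * cell1 C |
     exists a, dom (vert C) a = fst p /\ cod (vert C) a = snd p}.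

Definition iclass (C : two_cat) (a : cell2 C) : icell2 C :=
  exist _ (dom (vert C) a, cod (vert C) a)
    (ex_intro _ a (conj eq_refl eq_refl)).

Lemma sig_eq (T : Type) (P : T -> Prop) (u v : {x | P x}) :
  proj1_sig u = proj1_sig v -> u = v.
Proof.
destruct u as [x p], v as [y q]; simpl; intros; subst.
f_equal; apply proof_irrelevance.
Qed.

Lemma icell2_eq (C : two_cat) (u v : icell2 C) :
  fst (proj1_sig u) = fst (proj1_sig v) ->
  snd (proj1_sig u) = snd (proj1_sig v) -> u = v.
Proof.
intros E1 E2; apply sig_eq.
destruct (proj1_sig u), (proj1_sig v); simpl in *; now subst.
Qed.

Lemma iclass_surj (C : two_cat) (u : icell2 C) : exists a, iclass a = u.
Proof.
destruct u as [[f g] [a [Ef Eg]]]; exists a.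
now apply icell2_eq.
Qed.

Section Reflector.
Variable C : two_cat.

Definition ivdom (u : icell2 C) : cell1 C := fst (proj1_sig u).
Definition ivcod (u : icell2 C) : cell1 C := snd (proj1_sig u).
Definition ihdom (u : icell2 C) : cell0 C := dom (base C) (ivdom u).
Definition ihcod (u : icell2 C) : cell0 C := cod (base C) (ivdom u).

Definition ivcomp (v u : icell2 C) (p : ivdom v = ivcod u) : icell2 C.
Proof.
refine (exist _ (ivdom u, ivcod v) _).
destruct v as [[g' h] [b [Eg' Eh]]], u as [[f g] [a [Ef Eg]]].
unfold ivdom, ivcod in *; simpl in *.
assert (q : dom (vert C) b = cod (vert C) a) by congruence.
exists (comp (vert C) b a q).
now rewrite dom_comp, cod_comp.
Defined.

Lemma ihdom_ivcod (u : icell2 C) : dom (base C) (ivcod u) = ihdom u.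
Proof.
destruct (iclass_surj u) as [a <-]; unfold ihdom, ivdom, ivcod; simpl.
now rewrite hdom_vdom, hdom_vcod.
Qed.

Lemma ihcod_ivcod (u : icell2 C) : cod (base C) (ivcod u) = ihcod u.
Proof.
destruct (iclass_surj u) as [a <-]; unfold ihcod, ivdom, ivcod; simpl.
now rewrite hcod_vdom, hcod_vcod.
Qed.

Lemma ihcomp_cod (v u : icell2 C) :
  ihdom v = ihcod u -> dom (base C) (ivcod v) = cod (base C) (ivcod u).
Proof. now rewrite ihdom_ivcod, ihcod_ivcod. Qed.

Definition ihcomp (v u : icell2 C) (p : ihdom v = ihcod u) : icell2 C.
Proof.
refine (exist _ (comp (base C) (ivdom v) (ivdom u) p,
                 comp (base C) (ivcod v) (ivcod u) (ihcomp_cod p)) _).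
generalize (ihcomp_cod p); revert p.
destruct (iclass_surj v) as [b <-], (iclass_surj u) as [a <-].
unfold ihdom, ihcod, ivdom, ivcod; simpl; intros p p'.
assert (q : dom (horiz C) b = cod (horiz C) a)
  by (rewrite <- hdom_vdom, <- hcod_vdom; exact p).
exists (comp (horiz C) b a q).
now rewrite (vdom_hcomp q p), (vcod_hcomp q p').
Defined.

Definition ivert : cat_on (cell1 C) (icell2 C).
Proof.
refine {| dom := ivdom; cod := ivcod; idn f := iclass (idn (vert C) f);
          comp := ivcomp |}; intros;
  unfold ivdom, ivcod in *; simpl;
  try apply icell2_eq; simpl; unfold ivdom, ivcod; simpl;
  rewrite ?dom_idn, ?cod_idn; auto.
Defined.

Definition ihoriz : cat_on (cell0 C) (icell2 C).
Proof.
refine {| dom := ihdom; cod := ihcod; idn x := iclass (idn (horiz C) x);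
          comp := ihcomp |}; intros.
- unfold ihdom, ivdom; simpl; now rewrite hdom_vdom, dom_idn.
- unfold ihcod, ivdom; simpl; now rewrite hcod_vdom, cod_idn.
- unfold ihdom, ivdom; simpl; now rewrite dom_comp.
- unfold ihcod, ivdom; simpl; now rewrite cod_comp.
- apply icell2_eq; simpl; apply comp_idr'; unfold ivdom, ivcod; simpl;
    rewrite <- vidn_idn, ?dom_idn, ?cod_idn;
    [reflexivity|f_equal; symmetry; apply ihdom_ivcod].
- apply icell2_eq; simpl; apply comp_idl'; unfold ivdom, ivcod; simpl;
    rewrite <- vidn_idn, ?dom_idn, ?cod_idn;
    [reflexivity|f_equal; symmetry; apply ihcod_ivcod].
- apply icell2_eq; simpl; apply comp_assoc.
Defined.

Definition icat : two_cat.
Proof.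
refine {| base := base C; vert := ivert; horiz := ihoriz |}; simpl; intros.
- reflexivity.
- apply ihdom_ivcod.
- reflexivity.
- apply ihcod_ivcod.
- now apply comp_congr.
- now apply comp_congr.
- now rewrite vidn_idn.
- apply icell2_eq; simpl.
  + rewrite dom_idn; apply comp_congr; unfold ivdom; simpl;
      now rewrite dom_idn.
  + rewrite cod_idn; apply comp_congr; unfold ivcod; simpl;
      now rewrite cod_idn.
- apply icell2_eq; simpl; now apply comp_congr.
Defined.

Lemma icat_preorder : is_two_preorder icat.
Proof. intros a b; apply (@icell2_eq C). Qed.

Definition eta : two_functor C icat.
Proof.
refine (@TwoFunctor C icat (fun x => x) (fun f => f) (@iclass C) _ _ _).
- apply preserves_cat_id.
- split; simpl; intros; try reflexivity.
  apply icell2_eq; simpl; [apply dom_comp|apply cod_comp].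
- split; simpl; intros.
  + apply hdom_vdom.
  + apply hcod_vdom.
  + reflexivity.
  + apply icell2_eq; simpl; [apply vdom_hcomp|apply vcod_hcomp].
Defined.

End Reflector.

Definition imap2 (C D : two_cat) (F : two_functor C D) (u : icell2 C) :
  icell2 D.
Proof.
refine (exist _ (map1 F (ivdom u), map1 F (ivcod u)) _).
destruct (iclass_surj u) as [a <-]; exists (map2 F a); simpl.
now rewrite (pres_dom (pres_vert F)), (pres_cod (pres_vert F)).
Defined.

Definition imap (C D : two_cat) (F : two_functor C D) :
  two_functor (icat C) (icat D).
Proof.
refine (@TwoFunctor (icat C) (icat D) (map0 F) (map1 F) (imap2 F) _ _ _).
- apply (pres_base F).
- split; simpl; intros; try reflexivity.
  + apply icell2_eq; simpl; unfold ivdom, ivcod; simpl;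
      now rewrite ?dom_idn, ?cod_idn.
  + now apply icell2_eq.
- split; simpl; intros.
  + apply (pres_dom (pres_base F)).
  + apply (pres_cod (pres_base F)).
  + apply icell2_eq; simpl; unfold ivdom, ivcod; simpl;
      rewrite <- !vidn_idn, ?dom_idn, ?cod_idn; apply (pres_idn (pres_base F)).
  + apply icell2_eq; simpl; apply (pres_comp (pres_base F)).
Defined.

Definition refl_preord : functor Cat2 Preord2.
Proof.
refine (@Functor Cat2 Preord2
  (fun C => exist _ (icat C) (@icat_preorder C)) (@imap) _ _).
- intros C; apply two_functor_eq; try reflexivity.
  now intros a; apply icell2_eq.
- intros C D E G F; apply two_functor_eq; try reflexivity.
  now intros a; apply icell2_eq.
Defined.

Lemma eta_natural (C D : two_cat) (F : two_functor C D) :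
  two_functor_cmp (eta D) F = two_functor_cmp (imap F) (eta C).
Proof.
apply two_functor_eq; simpl; try reflexivity; intros a.
apply icell2_eq; simpl;
  [apply (pres_dom (pres_vert F)) | apply (pres_cod (pres_vert F))].
Qed.

Lemma eta_universal (C D : two_cat) (F : two_functor C D) :
  is_two_preorder D ->
  exists! G : two_functor (icat C) D, two_functor_cmp G (eta C) = F.
Proof.
intros PD.
assert (ex : forall u : icell2 C, exists b : cell2 D,
  dom (vert D) b = map1 F (ivdom u) /\ cod (vert D) b = map1 F (ivcod u)).
{ intros u; destruct (iclass_surj u) as [a <-]; exists (map2 F a); split.
  - apply (pres_dom (pres_vert F)).
  - apply (pres_cod (pres_vert F)). }
pose (l u := proj1_sig (constructive_indefinite_description _ (ex u))).
assert (ld : forall u, dom (vert D) (l u) = map1 F (ivdom u))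
  by (intros u; apply (proj2_sig (constructive_indefinite_description _ (ex u)))).
assert (lc : forall u, cod (vert D) (l u) = map1 F (ivcod u))
  by (intros u; apply (proj2_sig (constructive_indefinite_description _ (ex u)))).
clearbody l.
assert (lE : forall a, l (iclass a) = map2 F a).
{ intros a; apply PD; rewrite ?ld, ?lc;
    now rewrite ?(pres_dom (pres_vert F)), ?(pres_cod (pres_vert F)). }
assert (Lv : preserves_cat (vert (icat C)) (vert D) (map1 F) l).
{ split; simpl; intros.
  - apply ld.
  - apply lc.
  - rewrite lE; apply (pres_idn (pres_vert F)).
  - apply PD; now rewrite ?dom_comp, ?cod_comp, ?ld, ?lc. }
assert (Lh : preserves_cat (horiz (icat C)) (horiz D) (map0 F) l).
{ split; simpl; intros.
  - rewrite <- hdom_vdom, ld; apply (pres_dom (pres_base F)).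
  - rewrite <- hcod_vdom, ld; apply (pres_cod (pres_base F)).
  - rewrite lE; apply (pres_idn (pres_horiz F)).
  - revert p q; destruct (iclass_surj g) as [b <-], (iclass_surj f) as [a <-].
    intros p q.
    assert (r : dom (horiz C) b = cod (horiz C) a)
      by (rewrite <- hdom_vdom, <- hcod_vdom; exact p).
    replace (ihcomp p) with (iclass (comp (horiz C) b a r)).
    + rewrite lE.
      assert (r' : dom (horiz D) (map2 F b) = cod (horiz D) (map2 F a))
        by now rewrite <- !lE.
      rewrite (pres_comp (pres_horiz F) r r').
      now apply comp_congr; rewrite lE.
    + apply icell2_eq; simpl; [apply vdom_hcomp|apply vcod_hcomp]. }
exists (@TwoFunctor (icat C) D (map0 F) (map1 F) l (pres_base F) Lv Lh); split.
- now apply two_functor_eq.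
- intros G <-; apply two_functor_eq; simpl; try reflexivity.
  intros u; destruct (iclass_surj u) as [a <-]; apply lE.
Qed.

Definition reflection_preord : adjunction refl_preord incl_preord.
Proof.
refine (@Adjunction Cat2 Preord2 refl_preord incl_preord eta _ _).
- exact eta_natural.
- intros C D F; exact (@eta_universal C (proj1_sig D) F (proj2_sig D)).
Defined.

Definition fprod (A B Z : Type) (f : A -> Z) (g : B -> Z) : Type :=
  {p : A * B | f (fst p) = g (snd p)}.

Definition fpair (A B Z : Type) (f : A -> Z) (g : B -> Z) a b
  (e : f a = g b) : fprod f g := exist _ (a, b) e.
Definition fpr1 (A B Z : Type) (f : A -> Z) (g : B -> Z) (p : fprod f g) : A :=
  fst (proj1_sig p).
Definition fpr2 (A B Z : Type) (f : A -> Z) (g : B -> Z) (p : fprod f g) : B :=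
  snd (proj1_sig p).

Lemma fprod_eq (A B Z : Type) (f : A -> Z) (g : B -> Z) (p q : fprod f g) :
  fpr1 p = fpr1 q -> fpr2 p = fpr2 q -> p = q.
Proof.
unfold fpr1, fpr2; intros E1 E2; apply sig_eq.
destruct (proj1_sig p), (proj1_sig q); simpl in *; now subst.
Qed.

Lemma fprodE (A B Z : Type) (f : A -> Z) (g : B -> Z) (p : fprod f g) :
  f (fpr1 p) = g (fpr2 p).
Proof. exact (proj2_sig p). Qed.

Section PullbackCatOn.
Variables (O1 A1 O2 A2 O A : Type).
Variables (S1 : cat_on O1 A1) (S2 : cat_on O2 A2) (S : cat_on O A).
Variables (F0 : O1 -> O) (F1 : A1 -> A) (G0 : O2 -> O) (G1 : A2 -> A).
Hypothesis HF : preserves_cat S1 S F0 F1.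
Hypothesis HG : preserves_cat S2 S G0 G1.

Definition pb_dom (p : fprod F1 G1) : fprod F0 G0.
Proof.
refine (@fpair _ _ _ F0 G0 (dom S1 (fpr1 p)) (dom S2 (fpr2 p)) _).
now rewrite <- (pres_dom HF), <- (pres_dom HG), fprodE.
Defined.

Definition pb_cod (p : fprod F1 G1) : fprod F0 G0.
Proof.
refine (@fpair _ _ _ F0 G0 (cod S1 (fpr1 p)) (cod S2 (fpr2 p)) _).
now rewrite <- (pres_cod HF), <- (pres_cod HG), fprodE.
Defined.

Definition pb_idn (x : fprod F0 G0) : fprod F1 G1.
Proof.
refine (@fpair _ _ _ F1 G1 (idn S1 (fpr1 x)) (idn S2 (fpr2 x)) _).
now rewrite (pres_idn HF), (pres_idn HG), fprodE.
Defined.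

Definition pb_comp (q p : fprod F1 G1) (e : pb_dom q = pb_cod p) :
  fprod F1 G1.
Proof.
refine (@fpair _ _ _ F1 G1
  (comp S1 (fpr1 q) (fpr1 p) (f_equal (@fpr1 _ _ _ F0 G0) e))
  (comp S2 (fpr2 q) (fpr2 p) (f_equal (@fpr2 _ _ _ F0 G0) e)) _).
assert (r : dom S (F1 (fpr1 q)) = cod S (F1 (fpr1 p)))
  by (rewrite (pres_dom HF), (pres_cod HF); f_equal;
      exact (f_equal (@fpr1 _ _ _ F0 G0) e)).
assert (r' : dom S (G1 (fpr2 q)) = cod S (G1 (fpr2 p)))
  by now rewrite <- !fprodE.
rewrite (pres_comp HF _ r), (pres_comp HG _ r').
apply comp_congr; apply fprodE.
Defined.

Definition pb_cat_on : cat_on (fprod F0 G0) (fprod F1 G1).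
Proof.
refine {| dom := pb_dom; cod := pb_cod; idn := pb_idn; comp := pb_comp |};
  intros; apply fprod_eq; unfold fpr1, fpr2; simpl;
  first [apply dom_idn | apply cod_idn | apply dom_comp | apply cod_comp
        | apply comp_idl | apply comp_idr | apply comp_assoc].
Defined.

Lemma pb_pr1 : preserves_cat pb_cat_on S1 (@fpr1 _ _ _ F0 G0) (@fpr1 _ _ _ F1 G1).
Proof. split; intros; try reflexivity; now apply comp_congr. Qed.

Lemma pb_pr2 : preserves_cat pb_cat_on S2 (@fpr2 _ _ _ F0 G0) (@fpr2 _ _ _ F1 G1).
Proof. split; intros; try reflexivity; now apply comp_congr. Qed.

Lemma pb_pair (OQ AQ : Type) (SQ : cat_on OQ AQ)
    (q0 : OQ -> fprod F0 G0) (q1 : AQ -> fprod F1 G1) :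
  preserves_cat SQ S1 (fun x => fpr1 (q0 x)) (fun a => fpr1 (q1 a)) ->
  preserves_cat SQ S2 (fun x => fpr2 (q0 x)) (fun a => fpr2 (q1 a)) ->
  preserves_cat SQ pb_cat_on q0 q1.
Proof.
intros K1 K2; split; intros; apply fprod_eq; simpl.
- apply (pres_dom K1).
- apply (pres_dom K2).
- apply (pres_cod K1).
- apply (pres_cod K2).
- apply (pres_idn K1).
- apply (pres_idn K2).
- apply (pres_comp K1).
- apply (pres_comp K2).
Qed.

End PullbackCatOn.

Section Pullback.
Variables (C D E : two_cat) (F : two_functor C E) (G : two_functor D E).

Definition pb : two_cat.
Proof.
refine {| base := pb_cat_on (pres_base F) (pres_base G);
          vert := pb_cat_on (pres_vert F) (pres_vert G);
          horiz := pb_cat_on (pres_horiz F) (pres_horiz G) |};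
  intros; apply fprod_eq; unfold fpr1, fpr2; simpl;
  first [apply hdom_vdom | apply hdom_vcod | apply hcod_vdom
        | apply hcod_vcod | apply vdom_hcomp | apply vcod_hcomp
        | apply vidn_idn | apply vidn_comp | apply interchange].
Defined.

Definition pb1 : two_functor pb C :=
  @TwoFunctor pb C _ _ _ (pb_pr1 _ _) (pb_pr1 _ _) (pb_pr1 _ _).
Definition pb2 : two_functor pb D :=
  @TwoFunctor pb D _ _ _ (pb_pr2 _ _) (pb_pr2 _ _) (pb_pr2 _ _).

Lemma pb_is_pullback : @is_pullback Cat2 C D E pb F G pb1 pb2.
Proof.
split; [apply two_functor_eq; simpl; intros; apply fprodE|].
intros Q q1 q2 e.
assert (e0 : forall x, map0 F (map0 q1 x) = map0 G (map0 q2 x))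
  by (intros x; exact (f_equal (fun K : two_functor Q E => map0 K x) e)).
assert (e1 : forall x, map1 F (map1 q1 x) = map1 G (map1 q2 x))
  by (intros x; exact (f_equal (fun K : two_functor Q E => map1 K x) e)).
assert (e2 : forall x, map2 F (map2 q1 x) = map2 G (map2 q2 x))
  by (intros x; exact (f_equal (fun K : two_functor Q E => map2 K x) e)).
unshelve eexists (@TwoFunctor Q pb (fun x => fpair (e0 x))
  (fun x => fpair (e1 x)) (fun x => fpair (e2 x)) _ _ _).
- apply pb_pair; [apply (pres_base q1)|apply (pres_base q2)].
- apply pb_pair; [apply (pres_vert q1)|apply (pres_vert q2)].
- apply pb_pair; [apply (pres_horiz q1)|apply (pres_horiz q2)].
- split; [split; now apply two_functor_eq|].
  intros u [<- <-]; apply two_functor_eq; intros; now apply fprod_eq.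
Qed.

End Pullback.

(* Main.v *)
From Stdlib Require Import ClassicalEpsilon.
Require Import Defs.

Set Implicit Arguments.
Unset Strict Implicit.
Unset Printing Implicit Defensive.

(** The functor [I] does not change 0-cells and 1-cells, and [eta C] is the
    identity on them, so its pullback [C x_{HI(C)} D -> D] is bijective on
    0-cells and 1-cells; it is also surjective on 2-cells, because [eta C] is.
    Applying [I] keeps these properties and makes the 2-functor injective on
    2-cells, since these are now determined by their boundaries. A 2-functor
    bijective on all cells is an isomorphism. *)

Lemma is_iso_cmp (A : category) (X Y Z : A) (g : hom Y Z) (f : hom X Y) :
  is_iso g -> is_iso f -> is_iso (cmp g f).
Proof.
intros [g' [Eg Eg']] [f' [Ef Ef']]; exists (cmp f' g'); split.
- now rewrite cmp_assoc, <- (cmp_assoc f' g' g), Eg, cmp_idr.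
- now rewrite cmp_assoc, <- (cmp_assoc g f f'), Ef', cmp_idr.
Qed.

Lemma is_iso_fmap (A B : category) (L : functor A B) (X Y : A) (f : hom X Y) :
  is_iso f -> is_iso (fmap L f).
Proof.
intros [g [E E']]; exists (fmap L g).
now rewrite <- !fmap_cmp, E, E', !fmap_id.
Qed.

(** Stable units concern arbitrary pullbacks; this comparison allows the work to be done on the
    explicit [pb] alone. *)
Lemma pullback_unique (A : category) (X Y Z P Q : A)
    (f : hom X Z) (g : hom Y Z) (p1 : hom P X) (p2 : hom P Y)
    (q1 : hom Q X) (q2 : hom Q Y) :
  is_pullback f g p1 p2 -> is_pullback f g q1 q2 ->
  exists u : hom P Q, is_iso u /\ cmp q2 u = p2.
Proof.
intros [Ep Up] [Eq Uq].
destruct (Uq P p1 p2 Ep) as [u [[u1 u2] _]].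
destruct (Up Q q1 q2 Eq) as [v [[v1 v2] _]].
exists u; split; [exists v; split|exact u2].
(* Both [cmp v u] and the identity mediate from the cone [p1], [p2] to itself, so both equal [w]. *)
- destruct (Up P p1 p2 Ep) as [w [_ Uw]].
  transitivity w; [symmetry|]; apply Uw; split; rewrite ?cmp_idr; trivial;
    rewrite cmp_assoc; congruence.
- destruct (Uq Q q1 q2 Eq) as [w [_ Uw]].
  transitivity w; [symmetry|]; apply Uw; split; rewrite ?cmp_idr; trivial;
    rewrite cmp_assoc; congruence.
Qed.

Definition bijective (A B : Type) (f : A -> B) : Prop :=
  (forall x y, f x = f y -> x = y) /\ (forall y, exists x, f x = y).

Lemma bijective_inverse (A B : Type) (f : A -> B) :
  bijective f -> exists g, (forall x, g (f x) = x) /\ (forall y, f (g y) = y).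
Proof.
intros [inj surj].
pose (g y := proj1_sig (constructive_indefinite_description _ (surj y))).
assert (fK : forall y, f (g y) = y)
  by (intros y; apply (proj2_sig (constructive_indefinite_description _ (surj y)))).
exists g; split; auto.
Qed.

Lemma preserves_cat_inverse (O A O' A' : Type)
    (S : cat_on O A) (S' : cat_on O' A') (F0 : O -> O') (F1 : A -> A')
    (G0 : O' -> O) (G1 : A' -> A) :
  (forall x, G0 (F0 x) = x) -> (forall y, F0 (G0 y) = y) ->
  (forall x, G1 (F1 x) = x) -> (forall y, F1 (G1 y) = y) ->
  preserves_cat S S' F0 F1 -> preserves_cat S' S G0 G1.
Proof.
intros K0 K0' K1 K1' HF; split.
- intros f; now rewrite <- (K0 (dom S _)), <- (pres_dom HF), K1'.
- intros f; now rewrite <- (K0 (cod S _)), <- (pres_cod HF), K1'.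
- intros x; now rewrite <- (K1 (idn S _)), (pres_idn HF), K0'.
- intros g f p q.
  (* Composability of the round trips lets [F1] distribute over the composite taken in [S]. *)
  assert (r : dom S' (F1 (G1 g)) = cod S' (F1 (G1 f))) by now rewrite !K1'.
  rewrite <- (K1 (comp S _ _ q)), (pres_comp HF q r).
  f_equal; now apply comp_congr.
Qed.

Lemma bijective_two_functor_is_iso (C D : two_cat) (F : two_functor C D) :
  bijective (map0 F) -> bijective (map1 F) -> bijective (map2 F) ->
  @is_iso Cat2 C D F.
Proof.
intros B0 B1 B2.
destruct (bijective_inverse B0) as [G0 [K0 K0']].
destruct (bijective_inverse B1) as [G1 [K1 K1']].
destruct (bijective_inverse B2) as [G2 [K2 K2']].
exists (@TwoFunctor D C G0 G1 G2
  (preserves_cat_inverse K0 K0' K1 K1' (pres_base F))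
  (preserves_cat_inverse K1 K1' K2 K2' (pres_vert F))
  (preserves_cat_inverse K0 K0' K2 K2' (pres_horiz F))).
split; now apply two_functor_eq.
Qed.

(** The fibre of [fpr2] over [b] is the fibre of [f] over [g b], a single point. *)
Lemma fpr2_bijective (A B Z : Type) (f : A -> Z) (g : B -> Z) :
  bijective f -> bijective (@fpr2 A B Z f g).
Proof.
intros [inj surj]; split.
- intros p q E; apply fprod_eq; [|exact E].
  apply inj; now rewrite !fprodE, E.
- intros b; destruct (surj (g b)) as [a Ea]; now exists (fpair Ea).
Qed.

(** A class of 2-cells is its boundary pair, so injectivity is needed only on 1-cells; surjectivity
    is inherited through representatives. *)
Lemma imap2_bijective (C D : two_cat) (F : two_functor C D) :
  (forall f g, map1 F f = map1 F g -> f = g) ->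
  (forall b, exists a, map2 F a = b) -> bijective (imap2 F).
Proof.
intros inj surj; split.
- intros u v E; apply icell2_eq; apply inj.
  + exact (f_equal (@ivdom D) E).
  + exact (f_equal (@ivcod D) E).
- intros v; destruct (iclass_surj v) as [b <-], (surj b) as [a <-].
  exists (iclass a); apply icell2_eq; simpl; symmetry;
    [apply (pres_dom (pres_vert F)) | apply (pres_cod (pres_vert F))].
Qed.

Lemma imap_pb2_eta_is_iso (C D : two_cat) (G : two_functor D (icat C)) :
  @is_iso Cat2 (icat (pb (eta C) G)) (icat D) (imap (pb2 (eta C) G)).
Proof.
assert (id_bij : forall T : Type, bijective (fun x : T => x))
  by (intros T; split; eauto).
assert (B1 : bijective (map1 (pb2 (eta C) G))) by apply fpr2_bijective, id_bij.
apply bijective_two_functor_is_iso.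
- apply fpr2_bijective, id_bij.
- exact B1.
- apply imap2_bijective; [apply B1|].
  (* A representative [c] of the class [map2 G d] pairs with [d] to a 2-cell of the pullback lying
     over [d]. *)
  intros d; destruct (iclass_surj (map2 G d)) as [c Ec].
  now exists (@fpair _ _ _ (map2 (eta C)) (map2 G) c d Ec).
Qed.

Theorem theorem5p2 : has_stable_units reflection_preord.
Proof.
intros C D g P p1 p2 HP.
destruct (pullback_unique HP (pb_is_pullback (eta C) g)) as [u [Hu <-]].
rewrite fmap_cmp; apply is_iso_cmp; [|now apply is_iso_fmap].
(* As [Preord2] is full in [Cat2], being an isomorphism means the same in both, by conversion. *)
exact (imap_pb2_eta_is_iso g).
Qed.
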